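(* Let $q=2^m$ with $m>1$ and let $c_1,c_2,c_3,\gamma\in\mathbb{F}_{q^2}$. Then $$f_1(x)=x+\gamma\,\mathrm{Tr}_q^{q^2}\bigl(c_1x+c_2x^2+c_3x^3+x^{q+2}\bigr)$$ is a permutation polynomial of $\mathbb{F}_{q^2}$ if and only if one of the following holds: (1) $\gamma=0$; (2) $\gamma\in\mathbb{F}_q^{*}$, $c_3=1$, $\mathrm{Tr}_q^{q^2}(c_2)\neq0$ and $\mathrm{Tr}_q^{q^2}(c_1)=\gamma^{-1}$; (3) $\gamma\in\mathbb{F}_q^{*}$, $c_3=1$, $\mathrm{Tr}_q^{q^2}(c_2)=0$ and $\mathrm{Tr}_q^{q^2}(c_1)\neq\gamma^{-1}$; (4) $\gamma\in\mathbb{F}_{q^2}\setminus\mathbb{F}_q$, $m$ is odd, and, with $A:=\mathrm{Tr}_q^{q^2}(c_3\gamma^3+\gamma^{q+2})$, $$A\neq0,\qquad \mathrm{Tr}_q^{q^2}(\gamma^2)+(c_3\gamma+\gamma^{q})^{q+1}=0,\qquad A\bigl(1+\mathrm{Tr}_q^{q^2}(c_1\gamma)\bigr)+\mathrm{Tr}_q^{q^2}(c_2^2\gamma^4)=0.$$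
   Context: $\mathbb{F}_q$ denotes the finite field with $q$ elements and $\mathbb{F}_q^*=\mathbb{F}_q\setminus\{0\}$. $\mathrm{Tr}_q^{q^2}:\mathbb{F}_{q^2}\to\mathbb{F}_q$ is the relative trace $\mathrm{Tr}_q^{q^2}(x)=x+x^q$. A polynomial $f$ over $\mathbb{F}_{q^2}$ is a permutation polynomial of $\mathbb{F}_{q^2}$ if the map $a\mapsto f(a)$ is a bijection of $\mathbb{F}_{q^2}$. *)

(* Defs.v *)
From mathcomp Require Import all_boot all_order all_algebra all_field.

Set Implicit Arguments.
Unset Strict Implicit.
Unset Printing Implicit Defensive.

Import GRing.Theory.
Local Open Scope ring_scope.

(* The relative trace from F_(q^2) to F_q, stated over any ring so that it
   applies to polynomials over F_(q^2) as well as to field elements. *)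
Definition reltrace (R : nzRingType) (q : nat) (x : R) : R := x + x ^+ q.

Definition permutation_poly (R : nzRingType) (f : {poly R}) : Prop :=
  bijective (fun a : R => f.[a]).

(* Tr(...) is applied to a polynomial here, so f1 is a genuine polynomial,
   whose value at a is a + g * Tr(c1 a + c2 a^2 + c3 a^3 + a^(q + 2)). *)
Definition f1 (R : nzRingType) (q : nat) (c1 c2 c3 g : R) : {poly R} :=
  'X + g%:P *
    reltrace q (c1%:P * 'X + c2%:P * 'X^2 + c3%:P * 'X^3 + 'X^(q + 2)).

(* Main.v *)
Require Import Defs.
From HB Require Import structures.
From mathcomp Require Import all_boot all_order all_algebra all_fingroup.
From mathcomp Require Import all_solvable all_field.
From mathcomp Require Import ring.

Import GRing.Theory.
Local Open Scope ring_scope.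

(** Write s x = x^q and Tr x = x + s x.  The map x |-> x + g T(x), where
    T(x) = Tr(c1 x + c2 x^2 + c3 x^3 + x^(q+2)), has values T(x) in F_q, so
    two points with the same image differ by g u with u in F_q, and u <> 0 if
    they are distinct.  Such a collision between u y and u (y + g) amounts,
    after division by u^3 and with w = 1/u, to an equation that is quadratic
    in w:

        A + phi(y) + E w + D w^2 = 0,   phi(y) = Tr(beta y + delta y^2),

    with delta = c3 g + s g, beta = c3 g^2 + (s g)^2, E = Tr(c2 g^2),
    D = 1 + Tr(c1 g) and A = Tr(g beta) = Tr(g^2 delta)
    ([inner_trace_shift], [collision_free]).  For g <> 0 the map is thus
    injective iff this equation has no solution with y in F_(q^2) and w in
    F_q^*.  In particular the additive map phi must not be onto F_q.

    If delta = 0, then phi is onto unless g lies in F_q.  For g in F_q one has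
    c3 = 1, A = 0 and phi = 0, and what remains is that E + D w has no nonzero
    root, i.e. that exactly one of E and D vanishes: these are the two cases
    with g in F_q^* ([injective_delta0]).

    If delta <> 0, write delta = e^2.  On the line F_q e^-1 the square terms
    cancel and phi is k e^-1 |-> k Tr(beta / e), hence onto unless beta = b e
    with b in F_q.  Then phi(y) = b z + z^2 with z = Tr(e y), which takes all
    values in F_q, and with t = Tr(g e) one has A = t^2 = b t.  The collision
    equation becomes a quadric t^2 + b z + z^2 + E w + D w^2 = 0 over F_q.
    Completing squares with h = z + sqrt(D) w makes it linear in w: for t = 0
    there is always a solution ([quadric_root_ex]); for t <> 0 (so b = t)
    there is none iff E^2 = t^2 D and X^2 + X + 1 has no root in F_q
    ([quadric_no_root_iff]), that is, iff A D + E^2 = 0 and m is odd.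
    Finally Tr(beta s(e)) = t (Tr g + e s(e)), so for t <> 0 the condition
    that b lies in F_q reads Tr g + e s(e) = 0, whose square is
    Tr(g^2) + delta s(delta) = 0; it also forces Tr g <> 0, so that g is not
    in F_q ([injective_delta_neq0]).

    The argument uses only that F_(q^2) is a perfect field of characteristic 2
    with a nontrivial involution s whose fixed field is larger than F_2, and
    is carried out in that setting ([injective_add_trace]). *)

(** * Perfect fields of characteristic 2 with an involution *)

Section CharTwoInvolution.

Variables (L : fieldType) (s : {rmorphism L -> L}).
Hypotheses (two0 : 2%:R = 0 :> L) (sK : involutive s).
Hypothesis sqrt_ex : forall x : L, exists y, y ^+ 2 = x.
Hypothesis s_neq_id : exists theta, s theta != theta.
Hypothesis fixed_gt2 : exists w, [/\ s w = w, w != 0 & w != 1].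

Local Notation tr x := (x + s x).

(* The ring tactic has no notion of characteristic; it is given the values of
   the small integer constants that occur after expansion. *)
Let three1 : 3%:R = 1 :> L.
Proof. by rewrite -[3%:R]/(1 *+ 3) mulrS two0 addr0. Qed.
Let four0 : 4%:R = 0 :> L.
Proof. by rewrite -[4%:R]/((2 * 2)%:R) natrM two0 mul0r. Qed.
Let opp1 : -1 = 1 :> L.
Proof. by apply/esym/eqP; rewrite -addr_eq0 -mulr2n two0. Qed.

Let addK2 (x : L) : x + x = 0.
Proof. by rewrite -mulr2n -mulr_natl two0 mul0r. Qed.

Let eq_add (x y : L) : (x + y == 0) = (x == y).
Proof. by rewrite addr_eq0 -mulN1r opp1 mul1r. Qed.

Lemma tr_eq0 x : (tr x == 0) = (s x == x).
Proof. by rewrite eq_add eq_sym. Qed.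

Lemma tr_fixed x : s (tr x) = tr x.
Proof. by rewrite rmorphD sK addrC. Qed.

(** The trace of an element outside the fixed field is nonzero, and the trace
    is linear over the fixed field; rescaling gives every value. *)
Lemma tr_mul_onto e z : e != 0 -> s z = z -> exists y, tr (e * y) = z.
Proof.
move=> e0 sz; have [th] := s_neq_id; rewrite -tr_eq0 => tr_th.
exists (e^-1 * (z / tr th * th)).
rewrite mulVKf // rmorphM fmorph_div tr_fixed sz -mulrDr.
by rewrite divfK.
Qed.

Lemma sqr_eq (x y : L) : x ^+ 2 = y ^+ 2 -> x = y.
Proof.
move=> exy; apply/eqP; rewrite -eq_add -sqrf_eq0.
have -> : (x + y) ^+ 2 = x ^+ 2 + y ^+ 2 by ring: two0.
by rewrite exy addK2.
Qed.

Lemma sqrt_fixed x : s x = x -> exists2 y, s y = y & y ^+ 2 = x.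
Proof.
move=> sx; have [y y2] := sqrt_ex x; exists y => //.
by apply: sqr_eq; rewrite -rmorphXn y2.
Qed.

(** With r^2 = d and h = z + r w the equation is
    h (h + b) + (e + b r) w = 0, which is linear in w.  If e = b r, then h = 0
    is a solution for every w; otherwise h determines w.  The third element of
    the fixed field is what allows h to avoid both 0 and b, so that w <> 0. *)
Lemma quadric_root_ex b e d : s b = b -> s e = e -> s d = d ->
  exists z w, [/\ s z = z, s w = w, w != 0 &
                  b * z + z ^+ 2 + e * w + d * w ^+ 2 = 0].
Proof.
move=> sb se /sqrt_fixed[r sr <-].
have [er|] := eqVneq e (b * r).
  (* h = 0 *)
  exists r, 1; split; rewrite ?rmorph1 ?oner_eq0 //.
  by rewrite er; ring: two0.
rewrite -eq_add => e0.
have [h [sh h0 hb]] : exists h, [/\ s h = h, h != 0 & h != b].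
  have [b1|b1] := eqVneq b 1; last first.
    by exists 1; rewrite rmorph1 oner_eq0 eq_sym.
  by have [w [sw w0 w1]] := fixed_gt2; exists w; rewrite b1.
set w := h * (h + b) / (e + b * r).
have sw : s w = w by rewrite /w !(rmorphM, rmorphD, fmorphV) /= sh sb se sr.
have we : (e + b * r) * w = h * (h + b) by rewrite /w mulrC divfK.
exists (h + r * w), w; split => //; first by rewrite rmorphD rmorphM sh sr sw.
  by rewrite /w !mulf_neq0 ?invr_eq0 // eq_add.
have -> : b * (h + r * w) + (h + r * w) ^+ 2 + e * w + r ^+ 2 * w ^+ 2 =
  h * (h + b) + (e + b * r) * w by ring: two0.
by rewrite we.
Qed.

(** With r^2 = d and h = z + r w the form is
    t^2 + t h + h^2 + (e + t r) w.  If e <> t r, then h = 0 gives a root with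
    w <> 0; if e = t r, what remains is t^2 (o^2 + o + 1) with o = h / t. *)
Lemma quadric_no_root_iff t e d : s t = t -> s e = e -> s d = d -> t != 0 ->
  (forall z w, s z = z -> s w = w -> w != 0 ->
     t ^+ 2 + t * z + z ^+ 2 + e * w + d * w ^+ 2 != 0) <->
  e ^+ 2 = t ^+ 2 * d /\ (forall o, s o = o -> o ^+ 2 + o + 1 != 0).
Proof.
move=> st se /sqrt_fixed[r sr <-] t0; split=> [nz | [e2 no] z w sz sw w0].
  have er : e = t * r.
    apply/eqP; rewrite -eq_add; apply/negPn/negP => k0.
    (* h = 0 *)
    pose w := t ^+ 2 / (e + t * r).
    have sw : s w = w by rewrite /w !(rmorphM, rmorphD, fmorphV) /= st se sr.
    have wk : (e + t * r) * w = t ^+ 2 by rewrite /w mulrC divfK.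
    have w0 : w != 0 by rewrite /w !mulf_neq0 ?invr_eq0.
    have := nz (r * w) w; rewrite rmorphM sr sw => /(_ erefl erefl w0)/eqP[].
    have -> : t ^+ 2 + t * (r * w) + (r * w) ^+ 2 + e * w + r ^+ 2 * w ^+ 2 =
      t ^+ 2 + (e + t * r) * w by ring: two0.
    by rewrite wk.
  split; first by rewrite er exprMn.
  move=> o so; apply/negP => /eqP oo.
  (* h = t o with w = 1 *)
  have := nz (t * o + r) 1; rewrite rmorph1 oner_eq0 rmorphD rmorphM st so sr.
  move=> /(_ erefl erefl isT)/eqP[]; rewrite er.
  have -> : t ^+ 2 + t * (t * o + r) + (t * o + r) ^+ 2 + t * r * 1
            + r ^+ 2 * 1 ^+ 2 = t ^+ 2 * (o ^+ 2 + o + 1) by ring: two0.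
  by rewrite oo mulr0.
have er : e = t * r by apply: sqr_eq; rewrite e2 exprMn.
have := no ((z + r * w) / t).
rewrite !(rmorphM, rmorphD, fmorphV) /= sz sr sw st => /(_ erefl).
apply: contraNN => /eqP eq0; apply/eqP/(mulfI (expf_neq0 2 t0)).
rewrite mulr0 -[RHS]eq0 er; field: two0.
all: by [].
Qed.

(** * Collisions of x + g T(x) *)

Variables (c1 c2 c3 g : L).

Definition inner_trace x :=
  tr (c1 * x + c2 * x ^+ 2 + c3 * x ^+ 3 + s x * x ^+ 2).

Let T := inner_trace.
Let delta := c3 * g + s g.
Let beta := c3 * g ^+ 2 + s g ^+ 2.
Let A := tr (c3 * g ^+ 3 + s g * g ^+ 2).
Let E := tr (c2 * g ^+ 2).
Let D := 1 + tr (c1 * g).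
Let phi y := tr (beta * y + delta * y ^+ 2).

Let A_beta : A = tr (g * beta).
Proof. by rewrite /A /beta !(rmorphM, rmorphD, rmorphXn) /= sK; ring. Qed.
Let A_delta : A = tr (g ^+ 2 * delta).
Proof. by rewrite /A /delta !(rmorphM, rmorphD, rmorphXn) /= sK; ring. Qed.

Let sA : s A = A. Proof. exact: tr_fixed. Qed.
Let sE : s E = E. Proof. exact: tr_fixed. Qed.
Let sD : s D = D. Proof. by rewrite /D rmorphD rmorph1 tr_fixed. Qed.

(** Multiplied by g, the left-hand side is the sum of the images of u (y + g)
    and u y.  Writing the points as multiples of u makes the cubic terms
    homogeneous, so that on the right y occurs only in phi. *)
Lemma inner_trace_shift u y : s u = u ->
  u + T (u * (y + g)) + T (u * y) = u ^+ 3 * (A + phi y) + u ^+ 2 * E + u * D.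
Proof.
move=> su; rewrite /T /inner_trace /A /phi /beta /delta /E /D.
rewrite !(rmorphD, rmorphM, rmorphXn) /= !sK su.
ring: two0 three1 four0.
Qed.

(** Two points with the same image differ by g u with u = T x + T x' fixed,
    so that they are u y and u (y + g); here w = u^-1. *)
Lemma collision_free : g != 0 ->
  injective (fun x => x + g * T x) <->
  (forall y w, s w = w -> w != 0 -> A + phi y + E * w + D * w ^+ 2 != 0).
Proof.
move=> g0; split=> [inj y w sw w0 | free x x' /= eq_f].
  apply/eqP => eq0; pose u := w^-1.
  have su : s u = u by rewrite fmorphV sw.
  have u0 : u != 0 by rewrite invr_eq0.
  have eqT : u + T (u * (y + g)) + T (u * y) = 0.
    rewrite inner_trace_shift // -[RHS](mulr0 (u ^+ 3)) -eq0 /u.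
    by field.
  have /inj/eqP : u * (y + g) + g * T (u * (y + g)) = u * y + g * T (u * y).
    apply/eqP; rewrite -eq_add -(mulr0 g) -eqT; apply/eqP; ring: two0.
  by rewrite mulrDr -subr_eq0 addrC addKr mulf_eq0 (negPf u0) (negPf g0).
apply/eqP; rewrite -eq_add; apply/negPn/negP => xx'.
pose u := T x + T x'.
have gu : g * u = x + x'.
  apply/eqP; rewrite -eq_add; apply/eqP.
  have -> : g * u + (x + x') = (x + g * T x) + (x' + g * T x') by rewrite /u; ring.
  by rewrite eq_f addK2.
have u0 : u != 0 by apply: contraNneq xx' => u0; rewrite -gu u0 mulr0.
have su : s u = u by rewrite /u rmorphD !tr_fixed.
have /eqP[] := free (x' / u) u^-1 (etrans (fmorphV _ _) (congr1 _ su))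
  (etrans (congr1 _ (invr_eq0 u)) u0).
apply: (mulfI (expf_neq0 3 u0)); rewrite mulr0.
have := inner_trace_shift u (x' / u) su.
have -> : u * (x' / u) = x' by field.
have -> : u * (x' / u + g) = x.
  by rewrite mulrDr [u * g]mulrC gu mulrC divfK //; ring: two0.
have -> : u + T x + T x' = 0 by rewrite /u; ring: two0.
by move=> ->; field.
Qed.

(** If phi is onto, then the value A + E + D needed for a collision at w = 1
    is reached. *)
Lemma phi_onto_not_injective : g != 0 ->
  (forall z, s z = z -> exists y, phi y = z) ->
  ~ injective (fun x => x + g * T x).
Proof.
move=> g0 onto /(collision_free g0) free.
have fixS : s (A + E + D) = A + E + D.
  by rewrite (rmorphD s (A + E)) (rmorphD s A) sA sE sD.
have [y phiy] := onto _ fixS.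
have /eqP[] := free y 1 (rmorph1 _) (oner_neq0 _).
by rewrite phiy; ring: two0.
Qed.

Let beta_delta : beta = delta * g + s g * tr g.
Proof. by rewrite /beta /delta; ring: two0. Qed.

(** Here beta = s g * tr g.  If it is nonzero, then phi = tr (beta * _) is
    onto; otherwise g is fixed, A and phi vanish, and E w + D w^2 = 0 has a
    solution with w <> 0 iff E and D are both zero or both nonzero. *)
Lemma injective_delta0 : g != 0 -> delta = 0 ->
  injective (fun x => x + g * T x) <->
  s g = g /\ ((E == 0) != (D == 0)).
Proof.
move=> g0 d0.
have [trg|trg] := eqVneq (tr g) 0; last first.
  split=> [|[/eqP]]; last by rewrite -tr_eq0 (negPf trg).
  move/phi_onto_not_injective => [] // z sz.
  have b0 : beta != 0.
    by rewrite beta_delta d0 mul0r add0r mulf_neq0 ?fmorph_eq0.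
  have [y <-] := tr_mul_onto beta z b0 sz; exists y.
  by rewrite /phi d0 mul0r addr0.
have b0 : beta = 0 by rewrite beta_delta d0 trg mul0r mulr0 addr0.
have A0 : A = 0.
  by rewrite A_beta b0 mulr0 rmorph0 addr0.
have sg : s g = g by apply/eqP; rewrite -tr_eq0 trg.
have ph y : phi y = 0 by rewrite /phi b0 d0 !mul0r addr0 rmorph0 addr0.
rewrite collision_free //; split=> [free | [_ ED] y w sw w0].
  split=> //; have [e0|e0] := eqVneq E 0; have [dd0|dd0] := eqVneq D 0 => //.
    have /eqP[] := free 0 1 (rmorph1 _) (oner_neq0 _).
    by rewrite A0 ph e0 dd0 !mul0r !addr0.
  have sw : s (E / D) = E / D by rewrite fmorph_div sE sD.
  have w0 : E / D != 0 by rewrite mulf_neq0 ?invr_eq0.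
  have /eqP[] := free 0 (E / D) sw w0.
  rewrite A0 ph !add0r.
  have -> : E * (E / D) + D * (E / D) ^+ 2 = E ^+ 2 / D *+ 2 by field.
  by rewrite -mulr_natl two0 mul0r.
rewrite A0 ph !add0r; move: ED.
have [->|e0] := eqVneq E 0; have [->|dd0] := eqVneq D 0 => // _.
  by rewrite mul0r add0r mulf_neq0 ?expf_neq0.
by rewrite mul0r addr0 mulf_neq0.
Qed.

(** For delta = e^2 the substitution z = tr (e * y) turns the collision
    equation into a quadric over the fixed field, provided that b = beta / e is
    fixed; phi is onto otherwise.  Since A = t^2 = b t for t = tr (g * e), the
    condition A <> 0 separates the two lemmas on quadrics. *)
Lemma injective_delta_neq0 : g != 0 -> delta != 0 ->
  injective (fun x => x + g * T x) <->
  [/\ (forall o, s o = o -> o ^+ 2 + o + 1 != 0), A != 0,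
      tr (g ^+ 2) + delta * s delta = 0 & A * D + tr (c2 ^+ 2 * g ^+ 4) = 0].
Proof.
move=> g0; have [e e2] := sqrt_ex delta => d0.
have e0 : e != 0 by apply: contraNneq d0 => e0; rewrite -e2 e0 expr0n.
have se0 : s e != 0 by rewrite fmorph_eq0.
pose t := tr (g * e).
have st : s t = t by apply: tr_fixed.
have A_t : A = t ^+ 2.
  by rewrite A_delta /t -e2 !(rmorphM, rmorphD, rmorphXn) /=; ring: two0.
have E2 : tr (c2 ^+ 2 * g ^+ 4) = E ^+ 2.
  by rewrite /E !(rmorphM, rmorphXn) /=; ring: two0.
have norm2 : tr (g ^+ 2) + delta * s delta = (tr g + e * s e) ^+ 2.
  by rewrite -e2 !(rmorphM, rmorphXn) /=; ring: two0.
have tr_beta_se : tr (beta * s e) = t * (tr g + e * s e).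
  by rewrite beta_delta -e2 /t !(rmorphM, rmorphD, rmorphXn) /= !sK; ring: two0.
have phi_b b y : s b = b -> beta = b * e ->
    phi y = b * tr (e * y) + tr (e * y) ^+ 2.
  move=> sb eb; rewrite /phi eb -e2 !(rmorphM, rmorphD, rmorphXn) /= sb.
  by ring: two0.
have A_b b : s b = b -> beta = b * e -> A = b * t.
  by move=> sb eb; rewrite A_beta eb /t !rmorphM sb; ring.
have free_quadric b : s b = b -> beta = b * e ->
   (forall y w, s w = w -> w != 0 -> A + phi y + E * w + D * w ^+ 2 != 0) <->
   (forall z w, s z = z -> s w = w -> w != 0 ->
      t ^+ 2 + b * z + z ^+ 2 + E * w + D * w ^+ 2 != 0).
  move=> sb eb; split=> free.
    move=> z w sz sw w0; have [y ey] := tr_mul_onto e z e0 sz.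
    by have := free y w sw w0; rewrite A_t (phi_b b) // ey addrA.
  move=> y w sw w0; rewrite A_t (phi_b b) // addrA.
  by apply: free => //; apply: tr_fixed.
split=> [inj | [no A0 nrm AD]].
  pose b := beta / e; have eb : beta = b * e by rewrite /b divfK.
  have sb : s b = b.
    apply/eqP; rewrite -tr_eq0; apply/negPn/negP => trb.
    apply: phi_onto_not_injective inj => // z sz.
    have sk : s (z / tr b) = z / tr b by rewrite fmorph_div tr_fixed sz.
    (* On the line of multiples of e^-1, phi is linear with slope tr b. *)
    exists (z / tr b / e).
    have : tr b * (z / tr b) = z by rewrite mulrC divfK.
    move: (z / tr b) sk => k sk <-.
    have -> : phi (k / e) = tr (b * k + k ^+ 2).
      by rewrite /phi eb -e2 -exprMn mulrA mulrAC divfK // [e * _]mulrC divfK.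
    by rewrite !(rmorphM, rmorphD, rmorphXn) /= sk; ring: two0.
  clearbody b.
  move/(collision_free g0)/(free_quadric b sb eb) in inj.
  have t0 : t != 0.
    apply/eqP => t0; have [z [w [sz sw w0]]] := quadric_root_ex b E D sb sE sD.
    by have /eqP := inj z w sz sw w0; rewrite t0 expr0n add0r.
  have bt : b = t by apply: (mulIf t0); rewrite -(A_b b) // A_t.
  rewrite bt in inj.
  have [ED no] := (quadric_no_root_iff t E D st sE sD t0).1 inj.
  rewrite A_t expf_neq0 // E2 ED; split=> //.
  rewrite norm2; apply/eqP; rewrite sqrf_eq0 -(inj_eq (mulfI t0)) mulr0.
  rewrite -tr_beta_se tr_eq0 eb !rmorphM /= sK sb.
  by apply/eqP; ring.
have t0 : t != 0 by move: A0; rewrite A_t sqrf_eq0.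
have /eqP : tr g + e * s e = 0 by apply/eqP; rewrite -sqrf_eq0 -norm2 nrm.
move=> nrm1.
have eb : beta = beta / e * e by rewrite divfK.
have sb : s (beta / e) = beta / e.
  have /eqP : tr (beta * s e) = 0 by rewrite tr_beta_se (eqP nrm1) mulr0.
  rewrite tr_eq0 rmorphM sK => /eqP eq1.
  by rewrite fmorph_div; apply/eqP; rewrite eqr_div // eq1.
have bt : beta / e = t by apply: (mulIf t0); rewrite -(A_b _ sb eb) A_t.
apply/(collision_free g0)/(free_quadric _ sb eb); rewrite bt.
apply/(quadric_no_root_iff t E D st sE sD t0); split=> //.
by apply/eqP; rewrite -eq_add -E2 -A_t addrC AD.
Qed.

(** For a nonzero fixed g, E = g^2 tr c2 and D = g (g^-1 + tr c1), which
    translates [injective_delta0] into conditions on c1 and c2.  If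
    delta <> 0, a fixed g would give tr (g ^+ 2) = 0 and hence
    delta * s delta = 0. *)
Theorem injective_add_trace :
  injective (fun x => x + g * T x) <->
  [\/ g = 0,
      [/\ s g = g, g != 0, c3 = 1, tr c2 != 0 & tr c1 = g^-1],
      [/\ s g = g, g != 0, c3 = 1, tr c2 = 0 & tr c1 != g^-1] |
      [/\ s g != g /\ (forall o, s o = o -> o ^+ 2 + o + 1 != 0),
          A != 0, tr (g ^+ 2) + delta * s delta = 0 &
          A * D + tr (c2 ^+ 2 * g ^+ 4) = 0]].
Proof.
have [g0|g0] := eqVneq g 0.
  split=> [_ | _ x y]; first by constructor 1.
  by rewrite /= g0 !mul0r !addr0.
have fixED : s g = g -> (E == 0 = (tr c2 == 0)) * (D == 0 = (tr c1 == g^-1)).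
  move=> sg.
  have -> : E = g ^+ 2 * tr c2 by rewrite /E !(rmorphM, rmorphXn) /= sg; ring.
  have -> : D = g * (g^-1 + tr c1) by rewrite /D rmorphM sg /=; field.
  by rewrite (mulf_eq0 (g ^+ 2)) sqrf_eq0 (mulf_eq0 g)
    (negPf g0) /= (eq_add g^-1) [g^-1 == _]eq_sym.
have [d0|d0] := eqVneq delta 0.
  rewrite injective_delta0 //; split=> [[sg] | ].
    have c31 : c3 = 1.
      apply: (mulIf g0); apply/eqP; rewrite -eq_add mul1r -[X in _ + X]sg.
      exact/eqP.
    rewrite !fixED //; case: (eqVneq (tr c2) 0) => [c20|c20].
      by case: (eqVneq (tr c1)) => // c1g _; constructor 3.
    by case: (eqVneq (tr c1)) => // c1g _; constructor 2.
  case=> [g0' | [sg _ _ c20 c1g] | [sg _ _ c20 c1g] | [_]].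
  - by rewrite g0' eqxx in g0.
  - by rewrite !fixED // c1g eqxx (negPf c20).
  - by rewrite !fixED // c20 eqxx (negPf c1g).
  - by rewrite A_delta d0 mulr0 rmorph0 addr0 eqxx.
have c3_neq1 : s g = g -> c3 <> 1.
  by move=> sg c31; rewrite /delta c31 sg mul1r addK2 eqxx in d0.
rewrite injective_delta_neq0 //; split=> [[no A0 nrm AD] | ].
  constructor 4; split=> //; split=> //; apply/eqP => sg.
  move/eqP: nrm; rewrite rmorphXn sg addK2 add0r mulf_eq0 fmorph_eq0.
  by rewrite (negPf d0).
case=> [g0' | [sg _ c31] | [sg _ c31] | [[_ no]]] //.
- by rewrite g0' eqxx in g0.
- by case: (c3_neq1 sg).
- by case: (c3_neq1 sg).
Qed.

End CharTwoInvolution.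

(** * The relative Frobenius of a quadratic extension of F_q, q = 2^m *)

(** For m even 3 divides 4^(m/2) - 1, and an element of order 3 of the
    multiplicative group is a root of (X^3 - 1) / (X - 1). *)
Lemma cyclotomic3_root_even (K : finFieldType) (m : nat) :
  ~~ odd m -> #|K| = (2 ^ m)%N ->
  exists o : K, o ^+ 2 + o + 1 = 0.
Proof.
move=> m_even cardK.
have dvd3 : (3 %| #|[set: {unit K}]|)%N.
  rewrite card_finField_unit cardK -subn1 -eqn_mod_dvd ?expn_gt0 //.
  rewrite -[m]odd_double_half (negPf m_even) add0n -mul2n expnM.
  by rewrite -modnXm exp1n.
have [u _ ord_u] := Cauchy (isT : prime 3) dvd3.
have u3 : val u ^+ 3 = 1 by rewrite -FinRing.val_unitX -ord_u expg_order.
have u1 : val u != 1.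
  apply/eqP => u1; have u_id : u = 1%g by apply: val_inj; rewrite u1.
  by move: ord_u; rewrite u_id order1.
exists (val u); apply: (mulfI (_ : val u - 1 != 0)); first by rewrite subr_eq0.
have -> : (val u - 1) * (val u ^+ 2 + val u + 1) = val u ^+ 3 - 1 by ring.
by rewrite u3 subrr mulr0.
Qed.

(** A root o satisfies o^2 = o + 1 and o^4 = o, so an odd power of the
    Frobenius moves it to o + 1. *)
Lemma cyclotomic3_no_root_odd (F : fieldType) (m : nat) (o : F) :
  2 \in [pchar F] -> odd m -> o ^+ (2 ^ m) = o -> o ^+ 2 + o + 1 != 0.
Proof.
move=> char2 m_odd o_fixed; apply/eqP => oo.
have two0 : 2%:R = 0 :> F := pcharf0 char2.
have o2 : o ^+ 2 = o + 1.
  by apply/eqP; rewrite -[o + 1](oppr_pchar2 char2) -addr_eq0 addrA oo.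
have o4 : o ^+ 4 = o.
  rewrite (exprM o 2 2) o2.
  have -> : (o + 1) ^+ 2 = o ^+ 2 + 1 by ring: two0.
  by rewrite o2; ring: two0.
have pow k : o ^+ (2 ^ k.*2.+1) = o + 1.
  elim: k => [|k IHk]; first by rewrite expn1.
  have -> : (2 ^ k.+1.*2.+1 = 4 * 2 ^ k.*2.+1)%N.
    by rewrite doubleS 2!expnS mulnA.
  by rewrite exprM o4.
move: o_fixed; rewrite -[m]odd_double_half m_odd add1n pow => /eqP.
by rewrite -subr_eq0 addrC addKr oner_eq0.
Qed.

Section RelativeFrobenius.

Variables (m q : nat) (K : finFieldType) (L : fieldExtType K).
Hypotheses (q_def : q = (2 ^ m)%N) (cardK : #|K| = q) (dimL : \dim {:L} = 2%N).
Hypothesis m_gt1 : (1 < m)%N.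

Lemma pchar2_ext : 2 \in [pchar L].
Proof. by rewrite (pchar_lalg L) (card_finPcharP (n := m)) // cardK q_def. Qed.

Let two0 : 2%:R = 0 :> L := pcharf0 pchar2_ext.

Lemma mem1v_frobenius (x : L) : (x \in 1%VS) = (x ^+ q == x).
Proof. by rewrite (Fermat's_little_theorem 1%AS) dimv1 expn1 cardK. Qed.

Definition frobenius (x : L) := x ^+ q.

Lemma frobenius_is_zmod_morphism : zmod_morphism frobenius.
Proof.
move=> x y; rewrite /frobenius !(oppr_pchar2 pchar2_ext) exprDn_pchar //.
by rewrite q_def pnatX (pnatE _ (isT : prime 2)) pchar2_ext.
Qed.

Lemma frobenius_is_monoid_morphism : monoid_morphism frobenius.
Proof. by split=> [|x y]; rewrite /frobenius (expr1n, exprMn). Qed.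

HB.instance Definition _ :=
  GRing.isZmodMorphism.Build L L frobenius frobenius_is_zmod_morphism.
HB.instance Definition _ :=
  GRing.isMonoidMorphism.Build L L frobenius frobenius_is_monoid_morphism.

Lemma frobenius_involutive : involutive frobenius.
Proof.
move=> x; apply/eqP; rewrite /frobenius -exprM mulnn.
by have := Fermat's_little_theorem {:L}%AS x; rewrite memvf dimL cardK => <-.
Qed.

(** The exponent q 2^(m-1) is half of q^2, and x^(q^2) = x. *)
Lemma square_root_ex (x : L) : exists y, y ^+ 2 = x.
Proof.
exists (x ^+ (q * 2 ^ m.-1)); rewrite -exprM -mulnA -expnSr prednK; last exact: ltnW.
by rewrite -q_def exprM [LHS]frobenius_involutive.
Qed.

Lemma frobenius_neq_id : exists th, frobenius th != th.
Proof.
have /subvPn[th _ th1] : ~~ ({:L} <= 1)%VS.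
  by apply/negP => /dimvS; rewrite dimL dimv1.
by exists th; rewrite -mem1v_frobenius.
Qed.

Lemma frobenius_fixed_gt2 : exists w, [/\ frobenius w = w, w != 0 & w != 1].
Proof.
have /card_gt0P[w] : (0 < #|[predC pred2 (0%R : K) 1%R]|)%N.
  rewrite -(ltn_add2l #|pred2 (0%R : K) 1%R|) cardC card2 cardK q_def addn0.
  by apply: (@leq_trans (2 ^ 2)); [case: eqP | rewrite leq_exp2l].
rewrite !inE negb_or => /andP[w0 w1]; exists (in_alg L w).
rewrite fmorph_eq0 fmorph_eq1 w0 w1; split=> //; apply/eqP.
by rewrite -mem1v_frobenius [in_alg L w]/(w *: 1) rpredZ ?mem1v.
Qed.

Lemma permutation_poly_f1 (c1 c2 c3 g : L) :
  permutation_poly (f1 q c1 c2 c3 g) <->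
  injective (fun x => x + g * inner_trace L frobenius c1 c2 c3 x).
Proof.
have f1E : (fun a => (f1 q c1 c2 c3 g).[a]) =1
    (fun x => x + g * inner_trace L frobenius c1 c2 c3 x).
  move=> x; rewrite /f1 /reltrace /inner_trace /= /frobenius.
  by rewrite !(hornerD, hornerM, hornerC, hornerX, horner_exp) exprD.
split=> [/bij_inj inj x y /= | inj].
  by rewrite -!f1E => /inj.
have inj1 : injective (fun a => (f1 q c1 c2 c3 g).[a]).
  by apply: eq_inj inj _ => x; rewrite f1E.
exact: (@injF_bij (finvect_type L) _ inj1).
Qed.

Lemma frobenius_cyclotomic3 :
  odd m <-> (forall o, frobenius o = o -> o ^+ 2 + o + 1 != 0).
Proof.
split=> [m_odd o fo | no].
  by apply: (cyclotomic3_no_root_odd L m o pchar2_ext m_odd); rewrite -q_def.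
apply/negPn/negP => m_even.
have [|o oo] := cyclotomic3_root_even K m m_even; first by rewrite cardK.
have fo : frobenius (in_alg L o) = in_alg L o.
  by apply/eqP; rewrite -mem1v_frobenius [in_alg L o]/(o *: 1) rpredZ ?mem1v.
move/eqP: (no _ fo); apply.
by rewrite -rmorphXn -[1](rmorph1 (in_alg L)) -!rmorphD oo rmorph0.
Qed.

Lemma permutation_poly_f1_iff (c1 c2 c3 g : L) :
  let Tr := @reltrace L q in
  let A := Tr (c3 * g ^+ 3 + g ^+ (q + 2)) in
  permutation_poly (f1 q c1 c2 c3 g) <->
  [\/ g = 0,
      [/\ g \in 1%VS, g != 0, c3 = 1, Tr c2 != 0 & Tr c1 = g^-1],
      [/\ g \in 1%VS, g != 0, c3 = 1, Tr c2 = 0 & Tr c1 != g^-1] |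
      [/\ g \notin 1%VS /\ odd m,
          A != 0,
          Tr (g ^+ 2) + (c3 * g + g ^+ q) ^+ (q + 1) = 0 &
          A * (1 + Tr (c1 * g)) + Tr (c2 ^+ 2 * g ^+ 4) = 0]].
Proof.
move=> Tr A; rewrite permutation_poly_f1.
have := injective_add_trace L frobenius two0 frobenius_involutive square_root_ex
  frobenius_neq_id frobenius_fixed_gt2 c1 c2 c3 g.
have AE : A = c3 * g ^+ 3 + frobenius g * g ^+ 2 +
              frobenius (c3 * g ^+ 3 + frobenius g * g ^+ 2).
  by rewrite /A /Tr /reltrace exprD.
have normE : (c3 * g + g ^+ q) ^+ (q + 1) =
  (c3 * g + frobenius g) * frobenius (c3 * g + frobenius g).
  by rewrite exprD expr1 mulrC.
rewrite normE -AE; move=> ->.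
rewrite mem1v_frobenius.
have oddP := frobenius_cyclotomic3.
split=> [] [g0 | [h1 h2 h3 h4 h5] | [h1 h2 h3 h4 h5] | [[h1 h2] h3 h4 h5]].
- by constructor 1.
- by constructor 2; split=> //; apply/eqP.
- by constructor 3; split=> //; apply/eqP.
- by constructor 4; split=> //; split=> //; apply/oddP.
- by constructor 1.
- by constructor 2; split=> //; apply/eqP.
- by constructor 3; split=> //; apply/eqP.
- by constructor 4; split=> //; split=> //; apply/oddP.
Qed.

End RelativeFrobenius.

Theorem theorem3p3 (m q : nat) (hm : (1 < m)%N) (hq : q = (2 ^ m)%N)
  (K : finFieldType) (hK : #|K| = q)
  (L : fieldExtType K) (hL : \dim {:L} = 2%N)
  (c1 c2 c3 gamma : L) :
  let Tr := @reltrace L q in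
  let A := Tr (c3 * gamma ^+ 3 + gamma ^+ (q + 2)) in
  permutation_poly (f1 q c1 c2 c3 gamma) <->
  [\/ gamma = 0,
      [/\ gamma \in 1%VS, gamma != 0, c3 = 1, Tr c2 != 0 & Tr c1 = gamma^-1],
      [/\ gamma \in 1%VS, gamma != 0, c3 = 1, Tr c2 = 0 & Tr c1 != gamma^-1] |
      [/\ gamma \notin 1%VS /\ odd m,
          A != 0,
          Tr (gamma ^+ 2) + (c3 * gamma + gamma ^+ q) ^+ (q + 1) = 0 &
          A * (1 + Tr (c1 * gamma)) + Tr (c2 ^+ 2 * gamma ^+ 4) = 0]].
Proof.
exact: permutation_poly_f1_iff.
Qed.
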